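(* Let $E$ be an infinite-dimensional multi-seminormed space which is approximately ultrahomogeneous. The following are equivalent: (i) $\mathrm{Age}_n(E)$ has the approximate Ramsey property (ARP) for each $n\in\mathbb N$ such that $1\le n\le\lambda_E$. (ii) $\mathrm{Iso}(E)$ is extremely amenable when endowed with the topology of pointwise convergence.
   Context: Conventions: $\omega=\{0,1,2,\dots\}$, $\mathbb N=\{1,2,\dots\}$; vector spaces are real; an integer $r$ is identified with $\{0,\dots,r-1\}$. A multi-seminormed space is a vector space $X$ with a sequence of seminorms $(\|\cdot\|_{X,n})_{n<\lambda_X}$, where $1\le\lambda_X\le\omega$ is its length (not necessarily separating points). $\mathrm{Emb}(X,Y)$ is the set of multi-isometric embeddings: injective linear $f:X\to Y$ (with $\lambda_X\le\lambda_Y$) such that $\|f(x)\|_{Y,m}=\|x\|_{X,m}$ for all $x\in X$, $m<\lambda_X$. $\mathrm{Iso}(E)$ is the group of surjective multi-isometric embeddings $E\to E$. For linear $h:X\to Y$ and $m<\lambda_X\le\lambda_Y$, $\|h\|_m:=\sup\{\|h(x)\|_{Y,m}:\|x\|_{X,m}\le1\}$. Topology of pointwise convergence on $\mathrm{Iso}(E)$: generated by the sets $\{g\in\mathrm{Iso}(E):\max_{m<n}\|(f-g)\restriction Y\|_m<\varepsilon\}$ with $f\in\mathrm{Iso}(E)$, $Y$ a finite-dimensional subspace of $E$, $\varepsilon>0$, $n\in\mathbb N$, $n\le\lambda_E$; equivalently, $f_k\to f$ iff $\|f_k(x)-f(x)\|_m\to0$ for each $x\in E$ and each $m<\lambda_E$.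 A topological group is extremely amenable if each of its continuous actions on a non-empty compact Hausdorff space has a common fixed point. $\mathrm{Age}(E)$ is the class of all $(X,(\|\cdot\|_{E,k})_{k<m})$ with $X$ a finite-dimensional linear subspace of $E$ and $1\le m\le\lambda_E$; $\mathrm{Age}_n(E)$ is its subclass of members of length exactly $n$. $E$ is approximately ultrahomogeneous if for every $\varepsilon>0$, $X\in\mathrm{Age}(E)$ and $\gamma,\eta\in\mathrm{Emb}(X,E)$ there is $g\in\mathrm{Iso}(E)$ with $\|g\circ\gamma-\eta\|_m\le\varepsilon$ for each $m<\lambda_X$. ARP: a class $\mathcal K$ of finite-dimensional multi-seminormed spaces of finite length has the (discrete) ARP if for every $X,Y\in\mathcal K$, $r\in\mathbb N$, $\varepsilon>0$ there is $Z\in\mathcal K$ such that for every $c:\mathrm{Emb}(X,Z)\to r$ there are $\gamma\in\mathrm{Emb}(Y,Z)$ and $i<r$ such that for every $\xi\in\gamma\circ\mathrm{Emb}(X,Y)$ there is $\eta\in\mathrm{Emb}(X,Z)$ with $c(\eta)=i$ and $\|\xi-\eta\|_m\le\varepsilon$ for all $m<\lambda_X$. This is equivalent to the continuous ARP: for every $X,Y\in\mathcal K$, $\varepsilon>0$ there is $Z\in\mathcal K$ such that for every $c:\mathrm{Emb}(X,Z)\to[0,1]$ with $|c(\gamma)-c(\eta)|\le\max_{m<\lambda_X}\|\gamma-\eta\|_m$ for all $\gamma,\eta$, there is $\rho\in\mathrm{Emb}(Y,Z)$ with $|c(\rho\circ\eta)-c(\rho\circ\eta')|\le\varepsilon$ for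 all $\eta,\eta'\in\mathrm{Emb}(X,Y)$. *)

(* Defs.v *)
From HB Require Import structures.
From mathcomp Require Import all_boot all_order all_algebra.
From mathcomp Require Import all_classical all_reals.
From mathcomp Require Import ereal topology normedtype.
From mathcomp Require Import lra.

Set Implicit Arguments.
Unset Strict Implicit.
Unset Printing Implicit Defensive.

Import Order.TTheory GRing.Theory Num.Theory.

Local Open Scope classical_set_scope.
Local Open Scope ring_scope.

(* [None] is the length omega. *)
Definition mslength := option nat.

Definition len_lt (m : nat) (l : mslength) : bool :=
  if l is Some n then (m < n)%N else true.

Definition len_le (l l' : mslength) : bool :=
  match l, l' with
  | Some n, Some n' => (n <= n')%N
  | None, Some _ => false
  | _, None => true
  end.

Record seminorm (R : realType) (V : lmodType R) (p : V -> R) : Prop := {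
  seminorm_ge0 : forall x, 0 <= p x ;
  seminormZ : forall (a : R) x, p (a *: x) = `|a| * p x ;
  seminormD : forall x y, p (x + y) <= p x + p y }.

(* The values of [msnorm m] for [m] not below the length are irrelevant. *)
Record multiseminormed (R : realType) := MultiSeminormed {
  mscarrier :> lmodType R ;
  mslen : mslength ;
  msnorm : nat -> mscarrier -> R ;
  mslen_ge1 : len_le (Some 1%N) mslen ;
  msnormP : forall m, len_lt m mslen -> seminorm (msnorm m) }.

Arguments msnorm {R} X m x : rename.

Section MultiSeminormedSpaces.
Context {R : realType}.
Implicit Types X Y Z E : multiseminormed R.

Record emb X Y := Emb {
  emb_lin :> {linear X -> Y} ;
  emb_len : len_le (mslen X) (mslen Y) ;
  emb_inj : injective emb_lin ;
  emb_norm : forall m, len_lt m (mslen X) ->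
    forall x, msnorm Y m (emb_lin x) = msnorm X m x }.

Record iso E := MkIso {
  iso_emb :> emb E E ;
  iso_surj : forall y, exists x, iso_emb x = y }.

(* The supremum may be +oo, hence the extended reals; [h] is meant linear. *)
Definition opnorm X Y (m : nat) (h : X -> Y) : \bar R :=
  ereal_sup [set (msnorm Y m (h x))%:E | x in [set x | msnorm X m x <= 1]].

Definition finite_dimensional (V : lmodType R) : Prop :=
  exists n (e : 'I_n -> V),
    forall x, exists c : 'I_n -> R, x = \sum_(i < n) c i *: e i.

Definition subspace_type (V : lmodType R) (S : submodClosed V) : Type :=
  {x : V | x \in S}.

HB.instance Definition _ (V : lmodType R) (S : submodClosed V) :=
  SubChoice.on (subspace_type S).
HB.instance Definition _ (V : lmodType R) (S : submodClosed V) :=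
  [SubChoice_isSubLmodule of subspace_type S by <:].

(* The member (S, (|| ||_{E,k})_{k<n}) of the age of E. *)
Section Restriction.
Variables (E : multiseminormed R) (S : submodClosed E) (n : nat).

Definition restr_norm (m : nat) (x : subspace_type S) : R :=
  msnorm E m (\val x).

Lemma restr_len_ge1 : (0 < n)%N -> len_le (Some 1%N) (Some n).
Proof. by []. Qed.

Lemma restr_normP : len_le (Some n) (mslen E) ->
  forall m, len_lt m (Some n) -> seminorm (restr_norm m).
Proof.
move=> nE m /= mn.
have /msnormP[p0 pZ pD] : len_lt m (mslen E).
  by case: (mslen E) nE => //= k; exact: leq_trans.
split=> [x|a x|x y]; rewrite /restr_norm.
- exact: p0.
- by rewrite linearZ pZ.
- by rewrite raddfD pD.
Qed.

Definition restr (n_gt0 : (0 < n)%N) (n_le : len_le (Some n) (mslen E)) :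
    multiseminormed R :=
  MultiSeminormed (restr_len_ge1 n_gt0) (restr_normP n_le).

End Restriction.

Definition Age_len E (n : nat) : multiseminormed R -> Prop :=
  fun X => exists (S : submodClosed E) (n_gt0 : (0 < n)%N)
             (n_le : len_le (Some n) (mslen E)),
           finite_dimensional (subspace_type S) /\ X = restr S n_gt0 n_le.

(* Members have finite length also when E has length omega. *)
Definition Age E : multiseminormed R -> Prop :=
  fun X => exists n, Age_len E n X.

Definition approximately_ultrahomogeneous E : Prop :=
  forall (eps : R) X, 0 < eps -> Age E X ->
  forall gamma eta : emb X E, exists g : iso E,
  forall m, len_lt m (mslen X) ->
    (opnorm m (fun x => g (gamma x) - eta x)%R <= eps%:E)%E.

(* [K] is a predicate rather than a [set] for universe reasons. *)
Definition approximate_ramsey (K : multiseminormed R -> Prop) : Prop :=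
  forall X Y, K X -> K Y -> forall (r : nat) (eps : R), (0 < r)%N -> 0 < eps ->
  exists2 Z, K Z &
  forall c : emb X Z -> 'I_r, exists (gamma : emb Y Z) (i : 'I_r),
  forall xi : emb X Y, exists2 eta : emb X Z, c eta = i &
  forall m, len_lt m (mslen X) ->
    (opnorm m (fun x => gamma (xi x) - eta x)%R <= eps%:E)%E.

Section IsoGroup.
Variable E : multiseminormed R.
Implicit Types f g h : iso E.

Lemma iso_eqP f g : f =1 g -> f = g.
Proof.
case: f g => [[f fl fi fn] fs] [[g gl gi gn] gs] /= fg.
have {}fg : f = g.
  case: f g fg {fl fi fn fs gl gi gn gs} => [f cf] [g cg] /= /funext fg.
  rewrite fg in cf cg *; congr GRing.Linear.Pack.
  case: cf cg => [[fD] [fZ]] [[gD] [gZ]].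
  by rewrite (Prop_irrelevance fD gD) (Prop_irrelevance fZ gZ).
rewrite fg in fl fi fn fs gl gi gn gs *.
rewrite (Prop_irrelevance fl gl) (Prop_irrelevance fi gi)
  (Prop_irrelevance fn gn) in fs *.
by congr MkIso; exact: Prop_irrelevance.
Qed.

Lemma len_leR (l : mslength) : len_le l l.
Proof. by case: l => //=. Qed.

Lemma iso_norm f m x : len_lt m (mslen E) -> msnorm E m (f x) = msnorm E m x.
Proof. by move=> mE; exact: emb_norm. Qed.

Definition iso_id : iso E :=
  MkIso (iso_emb := Emb (emb_lin := idfun) (len_leR _) (fun _ _ => id)
                       (fun _ _ _ => erefl))
       (fun y => ex_intro _ y erefl).

Lemma iso_comp_norm f g m : len_lt m (mslen E) ->
  forall x, msnorm E m ((f \o g) x) = msnorm E m x.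
Proof. by move=> mE x /=; rewrite !iso_norm. Qed.

Lemma iso_comp_surj f g y : exists x, (f \o g) x = y.
Proof.
have [x <-] := iso_surj f y; have [z <-] := iso_surj g x.
by exists z.
Qed.

Definition iso_comp f g : iso E :=
  MkIso (iso_emb := Emb (emb_lin := f \o g) (len_leR _)
                       (inj_comp (@emb_inj _ _ f) (@emb_inj _ _ g))
                       (@iso_comp_norm f g))
       (iso_comp_surj f g).

Definition iso_inv_fun f (y : E) : E := projT1 (cid (iso_surj f y)).

Lemma iso_inv_funK f : cancel (iso_inv_fun f) f.
Proof. by move=> y; rewrite /iso_inv_fun; case: cid. Qed.

Lemma iso_funK f : cancel f (iso_inv_fun f).
Proof. by move=> x; apply: (@emb_inj _ _ f); rewrite iso_inv_funK. Qed.

Lemma iso_inv_linear f : linear (iso_inv_fun f).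
Proof.
by move=> a x y; apply: (@emb_inj _ _ f); rewrite linearP !iso_inv_funK.
Qed.

HB.instance Definition _ (f : iso E) :=
  GRing.isLinear.Build R E E *:%R (iso_inv_fun f) (iso_inv_linear f).

Lemma iso_inv_norm f m : len_lt m (mslen E) ->
  forall x, msnorm E m (iso_inv_fun f x) = msnorm E m x.
Proof. by move=> mE x; rewrite -(iso_norm f _ mE) iso_inv_funK. Qed.

Definition iso_inv f : iso E :=
  MkIso (iso_emb := Emb (emb_lin := iso_inv_fun f) (len_leR _)
                       (can_inj (iso_inv_funK f)) (@iso_inv_norm f))
       (fun y => ex_intro _ (f y) (iso_funK f y)).

Fact iso_compA : associative iso_comp.
Proof. by move=> f g h; apply: iso_eqP => x. Qed.

Fact iso_comp1f : left_id iso_id iso_comp.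
Proof. by move=> f; apply: iso_eqP => x. Qed.

Fact iso_compf1 : right_id iso_id iso_comp.
Proof. by move=> f; apply: iso_eqP => x. Qed.

Fact iso_compVf : left_inverse iso_id iso_inv iso_comp.
Proof. by move=> f; apply: iso_eqP => x /=; rewrite iso_funK. Qed.

Fact iso_compfV : right_inverse iso_id iso_inv iso_comp.
Proof. by move=> f; apply: iso_eqP => x /=; rewrite iso_inv_funK. Qed.

HB.instance Definition _ := gen_eqMixin (iso E).
HB.instance Definition _ := gen_choiceMixin (iso E).
HB.instance Definition _ := isGroup.Build (iso E)
  iso_compA iso_comp1f iso_compf1 iso_compVf iso_compfV.

(* max_{m<n} ||(f - g)|Y||_m < eps, with the maximum unfolded; the topology
   below is the one generated by these sets. *)
Definition iso_subbase : set (set (iso E)) :=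
  [set U | exists (f : iso E) (Y : submodClosed E) (eps : R) (n : nat),
    exists (n_gt0 : (0 < n)%N) (n_le : len_le (Some n) (mslen E)),
    [/\ finite_dimensional (subspace_type Y), 0 < eps &
        U = [set g : iso E | forall m, (m < n)%N ->
          (opnorm m (fun y : restr Y n_gt0 n_le => f (\val y) - g (\val y))%R
             < eps%:E)%E]]].

HB.instance Definition _ :=
  isSubBaseTopological.Build (iso E) iso_subbase id.

End IsoGroup.

End MultiSeminormedSpaces.

HB.mixin Record isTopologicalGroup G & Group G & Topological G := {
  mulg_continuous : continuous (fun p : G * G => (p.1 * p.2)%g) ;
  invg_continuous : continuous (fun x : G => (x^-1)%g) }.

#[short(type="topologicalGroupType")]
HB.structure Definition TopologicalGroup :=
  {G of isTopologicalGroup G & Group G & Topological G}.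

(* Jointly continuous. *)
Record continuous_action (G : topologicalGroupType) (K : topologicalType)
    (a : G -> K -> K) : Prop := {
  act1 : forall x, a 1%g x = x ;
  actM : forall g h x, a (g * h)%g x = a g (a h x) ;
  act_continuous : continuous (fun p : G * K => a p.1 p.2) }.

Definition extremely_amenable (G : topologicalGroupType) : Prop :=
  forall (K : topologicalType) (a : G -> K -> K),
    [set: K] !=set0 -> compact [set: K] -> hausdorff_space K ->
    continuous_action a -> exists x, forall g, a g x = x.

Section IsoTopologicalGroup.
Context {R : realType}.
Variable E : multiseminormed R.
Implicit Types f g : iso E.

Lemma iso_subbase_nbhs U f : iso_subbase U -> U f -> nbhs f U.
Proof.
move=> sU Uf; apply: open_nbhs_nbhs; split => //.
exists [set U]; last by rewrite bigcup_set1.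
by move=> _ ->; exact: finI_from1.
Qed.

Lemma iso_cvg (F : set_system (iso E)) f : Filter F ->
  (forall U, iso_subbase U -> U f -> F U) -> F --> f.
Proof.
move=> FF FU A; rewrite nbhsE => -[_ [[B sB <-] [C BC Cf]] sA].
rewrite nbhs_filterE; apply: filterS sA _; apply: (@filterS _ _ _ C).
  by move=> g Cg; exists C.
have [D sD DC] := sB _ BC; rewrite -DC; apply: filter_bigI => U DU.
apply: FU; first by have := sD _ DU; rewrite inE.
by move: Cf; rewrite -DC => /(_ _ DU).
Qed.

Lemma le_opnorm (X Y : multiseminormed R) m (h : X -> Y) x :
  msnorm X m x <= 1 -> ((msnorm Y m (h x))%:E <= opnorm m h)%E.
Proof. by move=> x1; apply: ereal_sup_ubound; exists x. Qed.

Lemma opnorm_le (X Y : multiseminormed R) m (h : X -> Y) (c : R) :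
  (forall x, msnorm X m x <= 1 -> msnorm Y m (h x) <= c) ->
  (opnorm m h <= c%:E)%E.
Proof. by move=> hc; apply: ge_ereal_sup => _ [x x1 <-]; rewrite lee_fin hc. Qed.

Lemma lt_unif (a : nat -> \bar R) (eps : R) n :
  (forall m, (m < n)%N -> (a m < eps%:E)%E) ->
  exists2 c, c < eps & forall m, (m < n)%N -> (a m <= c%:E)%E.
Proof.
elim: n => [_|n IH aeps]; first by exists (eps - 1) => //; rewrite ltrBlDr ltrDl.
have [|c ceps ac] := IH; first by move=> m mn; exact/aeps/ltnW.
have [d deps ad] : exists2 d, d < eps & (a n <= d%:E)%E.
  have := aeps n (ltnSn n); case: (a n) => [r|//|_].
    by rewrite lte_fin => reps; exists r.
  by exists c => //; rewrite leNye.
exists (Num.max c d); first by rewrite gt_max ceps.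
move=> m; rewrite ltnS leq_eqVlt => /orP[/eqP->|/ac amc].
  by rewrite (le_trans ad)// lee_fin le_max lexx orbT.
by rewrite (le_trans amc)// lee_fin le_max lexx.
Qed.

Section Image.
Variables (g : iso E) (Y : submodClosed E).

Definition image_pred : {pred E} := fun x => iso_inv_fun g x \in Y.

Lemma image_submod : submod_closed image_pred.
Proof.
have imE x : (x \in image_pred) = (iso_inv_fun g x \in Y) by [].
split; first by rewrite imE linear0 rpred0.
by move=> a x y; rewrite !imE => xY yY; rewrite linearP rpredD ?rpredZ.
Qed.

HB.instance Definition _ := GRing.isSubmodClosed.Build R E image_pred image_submod.

Definition image_sub : submodClosed E := image_pred.

Lemma image_subP x : x \in Y -> g x \in image_sub.
Proof. by move=> xY; rewrite unfold_in /= /image_pred iso_funK. Qed.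

Lemma image_sub_fd : finite_dimensional (subspace_type Y) ->
  finite_dimensional (subspace_type image_sub).
Proof.
move=> [n [e eP]].
exists n, (fun i => exist _ (g (\val (e i))) (image_subP (valP (e i)))).
move=> [x xY]; have [c xE] := eP (exist _ (iso_inv_fun g x) xY).
exists c; apply: val_inj; rewrite [LHS]/= -[LHS](iso_inv_funK g).
have -> : iso_inv_fun g x = \val (\sum_(i < n) c i *: e i) by rewrite -xE.
rewrite !linear_sum; apply: eq_bigr => i _.
by rewrite !linearZ.
Qed.

End Image.

Lemma iso_len_lt n m : len_le (Some n) (mslen E) -> (m < n)%N ->
  len_lt m (mslen E).
Proof. by case: (mslen E) => //= k /[swap]; exact: leq_trans. Qed.

Definition iso_near f (Y : submodClosed E) (eps : R) (n : nat) : set (iso E) :=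
  [set g : iso E | forall m, (m < n)%N -> forall y, y \in Y ->
    msnorm E m y <= 1 -> msnorm E m (f y - g y) <= eps].

Lemma nbhs_iso_near f (Y : submodClosed E) (eps : R) n :
  (0 < n)%N -> len_le (Some n) (mslen E) ->
  finite_dimensional (subspace_type Y) -> 0 < eps ->
  nbhs f (iso_near f Y eps n).
Proof.
move=> n0 nE Yfd e0.
pose U := [set g : iso E | forall m, (m < n)%N ->
  (opnorm m (fun y : restr Y n0 nE => f (\val y) - g (\val y))%R < eps%:E)%E].
apply: (@filterS _ _ _ U).
  move=> g Ug m mn y yY y1; rewrite -lee_fin.
  apply: le_trans (ltW (Ug m mn)).
  exact: (@le_opnorm (restr Y n0 nE) E m _ (exist _ y yY)).
apply: iso_subbase_nbhs; first by exists f, Y, eps, n, n0, nE.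
move=> m mn; apply: (@le_lt_trans _ _ 0%:E); last by rewrite lte_fin.
have [p0 pZ _] := msnormP (iso_len_lt nE mn).
apply: opnorm_le => y _; rewrite subrr -(scale0r (0 : E)) pZ.
by rewrite normr0 mul0r.
Qed.

Lemma iso_mulg_continuous :
  continuous (fun p : iso E * iso E => (p.1 * p.2)%g).
Proof.
move=> [f0 g0]; apply: iso_cvg.
move=> _ [f [Y [eps [n [n0 [nE [Yfd e0 ->]]]]]]] /= /lt_unif[c ceps cP].
pose d := (eps - c) / 3.
have d0 : 0 < d by rewrite divr_gt0// subr_gt0.
exists (iso_near f0 (image_sub g0 Y) d n, iso_near g0 Y d n) => /=.
  by split; apply: nbhs_iso_near => //; exact: image_sub_fd.
move=> [f1 g1] [/= f1P g1P] m mn.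
have [p0 pZ pD] := msnormP (iso_len_lt nE mn).
apply: (@le_lt_trans _ _ (c + (d + d))%:E); last first.
  by rewrite lte_fin /d; lra.
apply: opnorm_le => -[y yY] /= y1.
have -> : f y - f1 (g1 y) =
    (f y - f0 (g0 y)) + ((f0 (g0 y) - f1 (g0 y)) + f1 (g0 y - g1 y)).
  by rewrite linearB (subrKA (f1 (g0 y))) (subrKA (f0 (g0 y))).
apply: le_trans (pD _ _) _; apply: lerD.
  rewrite -lee_fin; apply: le_trans (cP m mn).
  exact: (@le_opnorm (restr Y n0 nE) E m _ (exist _ y yY)).
apply: le_trans (pD _ _) _; apply: lerD.
  apply: f1P => //; first exact: image_subP.
  by rewrite iso_norm//; exact: iso_len_lt nE mn.
by rewrite iso_norm; [exact: g1P|exact: iso_len_lt nE mn].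
Qed.

Lemma iso_invg_continuous : continuous (fun f : iso E => (f^-1)%g).
Proof.
move=> g0; apply: iso_cvg; first by apply: (@fmap_filter _ _ _ _ (@nbhs_filter (iso E) g0)).
move=> _ [f [Y [eps [n [n0 [nE [Yfd e0 ->]]]]]]] /= /lt_unif[c ceps cP].
pose d := (eps - c) / 2.
have d0 : 0 < d by rewrite divr_gt0// subr_gt0.
apply: (@filterS _ (nbhs g0) _ _ _ _ (@nbhs_iso_near g0 _ d n n0 nE
  (@image_sub_fd (iso_inv g0) Y Yfd) d0)).
move=> g1 /= g1P m mn.
have lm := iso_len_lt nE mn.
have [p0 pZ pD] := msnormP lm.
apply: (@le_lt_trans _ _ (c + d)%:E); last by rewrite lte_fin /d; lra.
apply: opnorm_le => -[y yY] /= y1.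
rewrite -(subrKA (iso_inv g0 y)).
apply: le_trans (pD _ _) _; apply: lerD.
  rewrite -lee_fin; apply: le_trans (cP m mn).
  exact: (@le_opnorm (restr Y n0 nE) E m _ (exist _ y yY)).
have gy x : x - iso_inv_fun g1 y = iso_inv_fun g1 (g1 x - y).
  by rewrite linearB/= iso_funK.
rewrite gy iso_inv_norm// -{2}(iso_inv_funK g0 y).
have -> x z : msnorm E m (x - z) = msnorm E m (z - x).
  by rewrite -(opprB z x) -(scaleN1r (z - x)) pZ normrN1 mul1r.
apply: g1P => //; first exact: (@image_subP (iso_inv g0)).
by rewrite iso_inv_norm.
Qed.

HB.instance Definition _ := isTopologicalGroup.Build (iso E)
  iso_mulg_continuous iso_invg_continuous.

End IsoTopologicalGroup.

(* Main.v *)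
Require Import Defs.
From HB Require Import structures.
From mathcomp Require Import all_boot all_order all_algebra.
From mathcomp Require Import all_classical all_reals.
From mathcomp Require Import ereal topology normedtype.
From mathcomp Require Import lra.

(** Write G for the group of isometries of E.  Two isometries are close in G
exactly when they are close on some finitely generated subspace for finitely
many seminorms, and by approximate ultrahomogeneity every embedding of a member
X of the age into E is, up to a small error, the restriction of an element of
G.  So a function on G that is uniformly continuous for this topology is
essentially a function on the embeddings of some X into E, and both directions
translate between colorings of embeddings and functions on G.

From the Ramsey property to fixed points ([ramsey_extremely_amenable]).
Suppose that an action of G on a compact space K has no fixed point.  By
compactness there are finitely many small sets W_y that cover K, each inside a
V_y that is disjoint from one of its translates h_y V_y, such that a
neighbourhood N of 1 maps W_y into V_y ([fixed_point_free_cover]).  The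
neighbourhood N is controlled by a finite set t of vectors and finitely many
seminorms ([iso1_nbhs]); put X = span t and let Y be spanned by t and its
translates by the inverses of the h_y.  Fix a point x0 of K and color an
embedding eta of X by some y with k^-1 x0 in W_y, where the isometry k
approximates eta.  An almost monochromatic copy of Y, itself approximated by an
isometry l, yields a single y such that l^-1 x0 and h_y l^-1 x0 both lie in
V_y, which is absurd.

From fixed points to the Ramsey property ([extremely_amenable_ramsey]).
Suppose that the property fails for X, Y, r and eps.  Every finitely generated
subspace Z of E then carries a bad coloring of the embeddings of X in Z.
Replace it by the r functions that give the (truncated) distances to its color
classes.  These are Lipschitz functions on the embeddings of X in E, with
values in [0, 1], and a cluster point as Z grows shows that the set of bad
tuples of functions, [bad_colorings], is not empty.  It is a closed subset of a
product of unit intervals, and G acts on it by translation, jointly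
continuously because of the Lipschitz condition.  A fixed point consists of
constant functions, again by approximate ultrahomogeneity.  One of them
vanishes, since every embedding has a color, and none of them does, since every
copy of Y contains copies of X that are far from any given color.

For the last property to be closed, the copies of X in Y have to be drawn from
a finite list.  This is where finite dimension enters: the embeddings of X in Y
are totally bounded ([emb_net]), because bounded sets in a finite-dimensional
seminormed space are ([lspan_ball_finitely_colored]). *)

Set Implicit Arguments.
Unset Strict Implicit.
Unset Printing Implicit Defensive.

Import Order.TTheory GRing.Theory Num.Theory.
Import numFieldNormedType.Exports.

Local Open Scope classical_set_scope.
Local Open Scope ring_scope.

(** * Finite colorings *)

(** Total boundedness in the form of a finite partition into classes on which Q
holds.  Unlike finite nets, such partitions pull back along arbitrary maps and
combine by taking products. *)
Definition finitely_colored A (Q : A -> A -> Prop) : Prop :=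
  exists (T : finType) (k : A -> T), forall a b, k a = k b -> Q a b.

Section FiniteColorings.
Implicit Types A B : Type.

Lemma finitely_coloredW A (P Q : A -> A -> Prop) :
  (forall a b, P a b -> Q a b) -> finitely_colored P -> finitely_colored Q.
Proof. by move=> PQ [T [k kP]]; exists T, k => a b /kP/PQ. Qed.

Lemma finitely_colored_preim A B (f : A -> B) (Q : B -> B -> Prop) :
  finitely_colored Q -> finitely_colored (fun a b => Q (f a) (f b)).
Proof. by move=> [T [k kP]]; exists T, (k \o f) => a b /kP. Qed.

Lemma finitely_coloredI A (P Q : A -> A -> Prop) :
  finitely_colored P -> finitely_colored Q ->
  finitely_colored (fun a b => P a b /\ Q a b).
Proof.
move=> [T [k kP]] [U [l lQ]]; exists (T * U)%type, (fun a => (k a, l a)) => a b.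
by move=> [/kP ? /lQ ?].
Qed.

Lemma finitely_colored_seq A (I : eqType) (s : seq I)
    (Q : I -> A -> A -> Prop) :
  (forall i, i \in s -> finitely_colored (Q i)) ->
  finitely_colored (fun a b => forall i, i \in s -> Q i a b).
Proof.
elim: s => [_|i s IH Qs]; first by exists unit, (fun=> tt).
have [||] := @finitely_coloredI _ (Q i)
  (fun a b => forall j, j \in s -> Q j a b).
- by apply: Qs; rewrite mem_head.
- by apply: IH => j js; apply: Qs; rewrite in_cons js orbT.
move=> T [k kP]; exists T, k => a b /kP[Qi Qj] j.
by rewrite in_cons => /predU1P[->|/Qj].
Qed.

(** One representative per color among the points of P: a net inside P. *)
Lemma finitely_colored_net (A : eqType) (P : A -> Prop) (Q : A -> A -> Prop) :
  finitely_colored Q ->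
  exists s : seq A, (forall a, a \in s -> P a) /\
    forall a, P a -> exists2 b, b \in s & Q b a.
Proof.
move=> [T [k kQ]].
pose pick_in t := if pselect (exists2 a, P a & k a = t) is left e
  then Some (projT1 (cid2 e)) else None.
exists (pmap pick_in (enum T)); split=> [a|a Pa].
  rewrite mem_pmap => /mapP[t _]; rewrite /pick_in; case: pselect => // e [->].
  by case: cid2.
have e : exists2 b, P b & k b = k a by exists a.
exists (projT1 (cid2 e)); last by apply: kQ; case: cid2.
rewrite mem_pmap; apply/mapP; exists (k a); first by rewrite mem_enum.
rewrite /pick_in; case: pselect => // e'.
by rewrite (Prop_irrelevance e e').
Qed.

Lemma interval_finitely_colored (R : realType) (M d : R) : 0 < d ->
  finitely_colored (fun a b : R => `|a| <= M -> `|b| <= M -> `|a - b| <= d).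
Proof.
move=> d0; pose N := Num.truncn ((M + M) / d).
exists 'I_N.+1, (fun a => inord (Num.truncn ((a + M) / d))) => a b kab.
rewrite !ler_norml => /andP[aM1 aM2] /andP[bM1 bM2].
have M0 x : - M <= x -> 0 <= (x + M) / d.
  by move=> xM; rewrite divr_ge0// ?(ltW d0)//; lra.
have lN x : x <= M -> (Num.truncn ((x + M) / d) < N.+1)%N.
  by move=> xM; rewrite ltnS le_truncn// ler_pM2r ?invr_gt0// lerD2r.
have {}kab : Num.truncn ((a + M) / d) = Num.truncn ((b + M) / d).
  by have := congr1 val kab; rewrite /= !inordK ?lN.
have := truncn_itv (M0 _ aM1); have := truncn_itv (M0 _ bM1).
rewrite kab; move: (Num.truncn _) => m.
rewrite -natr1 !ler_pdivlMr// !ltr_pdivrMr// => /andP[b1 b2] /andP[a1 a2].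
by rewrite mulrDl mul1r in a2 b2; apply/andP; split; lra.
Qed.

End FiniteColorings.

(** * Seminorms and finite-dimensional spans *)

Section Seminorms.
Context {R : realType} {V : lmodType R} {p : V -> R} (sp : seminorm p).

Lemma seminorm0 : p 0 = 0.
Proof. by have [_ pZ _] := sp; rewrite -(scale0r (0 : V)) pZ normr0 mul0r. Qed.

Lemma seminormN x : p (- x) = p x.
Proof. by have [_ pZ _] := sp; rewrite -scaleN1r pZ normrN1 mul1r. Qed.

Lemma seminorm_distC x y : p (x - y) = p (y - x).
Proof. by rewrite -seminormN opprB. Qed.

Lemma seminorm_distD y x z : p (x - z) <= p (x - y) + p (y - z).
Proof. by have [_ _ pD] := sp; rewrite -(subrKA y); exact: pD. Qed.

(** A bound on the unit ball is also a bound on the kernel of p, which contains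
all multiples of its vectors; hence the estimate holds at every vector even when
p does not separate points. *)
Lemma seminorm_le_ball (W : lmodType R) (q : W -> R) (h : V -> W) (d : R) :
  seminorm q -> (forall a x, h (a *: x) = a *: h x) ->
  (forall x, p x <= 1 -> q (h x) <= d) -> forall x, q (h x) <= d * p x.
Proof.
move=> [q0 qZ _] hZ hd x; have [p0 pZ _] := sp.
have [px0|] := ltP 0 (p x).
  rewrite -ler_pdivrMr// mulrC -[X in X * _]ger0_norm ?invr_ge0//.
  by rewrite -qZ -hZ hd// pZ ger0_norm ?invr_ge0// mulVf// gt_eqF.
move=> px_le0; have px0 : p x = 0 by apply/le_anti; rewrite px_le0 p0.
rewrite px0 mulr0 leNgt; apply/negP => qx0.
have d0 : 0 <= d.
  by apply: le_trans (q0 (h 0)) _; rewrite hd// seminorm0 ler01.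
have := hd (((d + 1) / q (h x)) *: x).
rewrite hZ pZ qZ px0 mulr0 ler01 => /(_ isT).
rewrite ger0_norm ?divr_ge0//; last by rewrite addr_ge0.
rewrite divfK ?gt_eqF//; lra.
Qed.

End Seminorms.

Section Span.
Context {R : realType} {V : lmodType R}.
Implicit Types (s t : seq V) (x y e : V).

(** Recursion on the generators is what [lspan_ball_finitely_colored] needs:
peeling off one generator leaves a vector of the span of the others. *)
Fixpoint in_span s x : Prop :=
  if s is e :: s' then exists c : R, in_span s' (x - c *: e) else x = 0.

Definition lspan_pred s : {pred V} := fun x => `[< in_span s x >].

Lemma lspan_predE s x : (x \in lspan_pred s) = `[< in_span s x >].
Proof. by []. Qed.

Lemma lspan_submod s : submod_closed (lspan_pred s).
Proof.
split.
  rewrite lspan_predE; apply/asboolP; elim: s => //= e s IH.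
  by exists 0; rewrite scale0r subr0.
move=> a x y; rewrite !lspan_predE => /asboolP xs /asboolP ys; apply/asboolP.
elim: s x y xs ys => [x y -> ->|e s IH x y [c xs] [d ys]] /=.
  by rewrite scaler0 addr0.
exists (a * c + d); have := IH _ _ xs ys.
by rewrite scalerBr scalerDl opprD addrACA -!scalerA.
Qed.

HB.instance Definition _ s :=
  GRing.isSubmodClosed.Build R V (lspan_pred s) (lspan_submod s).

Definition lspan s : submodClosed V := lspan_pred s.

Lemma lspan_nilP x : x \in lspan [::] <-> x = 0.
Proof. by split=> [/asboolP|?]//; apply/asboolP. Qed.

Lemma lspan_consP e s x :
  x \in lspan (e :: s) <-> exists c : R, x - c *: e \in lspan s.
Proof.
split=> [/asboolP[c xs]|[c /asboolP xs]]; first by exists c; exact/asboolP.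
by apply/asboolP; exists c.
Qed.

Lemma lspan_sub s (S : submodClosed V) :
  {subset s <= S} -> {subset lspan s <= S}.
Proof.
elim: s => [_ x /lspan_nilP ->|e s IH sS x /lspan_consP[c xs]].
  by rewrite rpred0.
rewrite -(subrK (c *: e) x) rpredD//.
  by apply: IH => // y ys; apply: sS; rewrite in_cons ys orbT.
by rewrite rpredZ// sS// mem_head.
Qed.

Lemma mem_lspan s : {subset s <= lspan s}.
Proof.
elim: s => // e s IH x; rewrite in_cons => /predU1P[->|/IH xs].
  by apply/lspan_consP; exists 1; rewrite scale1r subrr rpred0.
by apply/lspan_consP; exists 0; rewrite scale0r subr0.
Qed.

Lemma lspan_mono s t : {subset s <= t} -> {subset lspan s <= lspan t}.
Proof. by move=> st; apply: lspan_sub => x /st; exact: mem_lspan. Qed.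

Lemma lspan_finite_dimensional s : finite_dimensional (subspace_type (lspan s)).
Proof.
have sP i : (i < size s)%N -> s`_i \in lspan s.
  by move=> ?; exact/mem_lspan/mem_nth.
exists (size s), (fun i : 'I_(size s) => exist _ s`_i (sP i (ltn_ord i))).
move=> [x xs].
suff [c xE] : exists c : 'I_(size s) -> R, x = \sum_i c i *: s`_i.
  exists c; apply: val_inj; rewrite [RHS]linear_sum /= xE; exact: eq_bigr.
elim: s x xs {sP} => [x /lspan_nilP ->|e s IH x /lspan_consP[a /IH[c xE]]].
  by exists (fun=> 0); rewrite big_ord0.
exists (fun i => oapp c a (unlift ord0 i)).
rewrite big_ord_recl unlift_none /= -(subrK (a *: e) x) addrC xE.
by congr +%R; apply: eq_bigr => i _; rewrite liftK.
Qed.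

Lemma finite_dimensional_lspan :
  finite_dimensional V -> exists s, forall x, x \in lspan s.
Proof.
move=> [n [e eP]]; exists [seq e i | i : 'I_n] => x.
have [c ->] := eP x; apply: rpred_sum => i _; rewrite rpredZ//.
by apply: mem_lspan; apply/mapP; exists i; rewrite ?mem_enum.
Qed.

(** Induction on the generators.  If e stays at positive distance from the span
of the other generators, the coefficient of e in x is bounded by a multiple of
p x, so that coefficient and the remaining part of x can be colored separately.
If e is at distance 0 from that span, every x is as close as wanted to a vector
of the smaller span, whose color is used instead. *)
Lemma lspan_ball_finitely_colored (p : V -> R) s (r d : R) :
  seminorm p -> 0 < d ->
  finitely_colored (fun x y => x \in lspan s -> y \in lspan s ->
    p x <= r -> p y <= r -> p (x - y) <= d).
Proof.
move=> sp; have [p0 pZ pD] := sp.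
elim: s r d => [r d d0|e s IH r d d0].
  exists unit, (fun=> tt) => x y _ /lspan_nilP -> /lspan_nilP -> _ _.
  by rewrite subrr (seminorm0 sp) ltW.
have [[D D0 De]|eNs] :=
    pselect (exists2 D, 0 < D & forall w, w \in lspan s -> D <= p (e + w)).
(* The case where e stays at distance at least D from the span of s. *)
- have /choice[c cP] : forall x, exists c : R,
      x \in lspan (e :: s) -> x - c *: e \in lspan s.
    move=> x; have [/lspan_consP[a xa]|xs] := boolP (x \in lspan (e :: s)).
      by exists a.
    by exists 0.
  have c_le x : x \in lspan (e :: s) -> p x <= r -> `|c x| <= r / D.
    move=> /cP xs xr; have [c0|c0] := eqVneq (c x) 0.
      by rewrite c0 normr0 divr_ge0 ?(ltW D0)// (le_trans _ xr).
    rewrite ler_pdivlMr//; apply: le_trans xr.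
    have -> : p x = `|c x| * p (e + (c x)^-1 *: (x - c x *: e)).
      by rewrite -pZ scalerDr scalerA mulfV// scale1r addrC subrK.
    by rewrite ler_wpM2l// De// rpredZ.
  have w_le x : x \in lspan (e :: s) -> p x <= r ->
      p (x - c x *: e) <= r + r / D * p e.
    move=> xs xr; apply: le_trans (pD _ _) _; rewrite (seminormN sp) pZ lerD//.
    by rewrite ler_wpM2r// c_le.
  have d1 : 0 < d / 2 / (p e + 1) by rewrite !divr_gt0// ltr_wpDl.
  have d2 : 0 < d / 2 by rewrite divr_gt0.
  have := finitely_coloredI
    (finitely_colored_preim c (interval_finitely_colored (r / D) d1))
    (finitely_colored_preim (fun x => x - c x *: e)
       (IH (r + r / D * p e) _ d2)).
  apply: finitely_coloredW => x y [xyc xyw] xs ys xr yr.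
  have := xyw (cP _ xs) (cP _ ys) (w_le _ xs xr) (w_le _ ys yr).
  have := xyc (c_le _ xs xr) (c_le _ ys yr).
  move=> cle wle.
  have -> : x - y =
      (c x - c y) *: e + ((x - c x *: e) - (y - c y *: e)).
    rewrite -{1}(subrK (c x *: e) x) -{1}(subrK (c y *: e) y).
    by rewrite opprD addrACA addrC scalerBl.
  apply: le_trans (pD _ _) _; rewrite pZ (splitr d) lerD//.
  apply: le_trans (_ : d / 2 / (p e + 1) * (p e + 1) <= _); last first.
    by rewrite divfK// gt_eqF// ltr_wpDl.
  by rewrite ler_pM// lerDl.
(* The case where e is a limit of vectors of the span of s. *)
- have /choice[f fP] : forall x, exists y, x \in lspan (e :: s) ->
      y \in lspan s /\ p (x - y) <= d / 3.
    move=> x; have [/lspan_consP[c xc]|xs] := boolP (x \in lspan (e :: s));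
      last by exists 0.
    have D0 : 0 < d / 3 / (`|c| + 1) by rewrite !divr_gt0// ltr_wpDl.
    have [w ws ew] : exists2 w, w \in lspan s & p (e + w) < d / 3 / (`|c| + 1).
      apply: contrapT => Nw; apply: eNs; exists (d / 3 / (`|c| + 1)) => // w ws.
      by rewrite leNgt; apply/negP => ew; apply: Nw; exists w.
    exists (x - c *: e - c *: w) => _; split; first by rewrite rpredB// rpredZ.
    rewrite -addrA -opprD -scalerDr subKr pZ.
    apply: le_trans (_ : (`|c| + 1) * (d / 3 / (`|c| + 1)) <= _).
      by rewrite ler_pM// ?lerDl// ltW.
    by rewrite mulrC divfK// gt_eqF// ltr_wpDl.
  have d3 : 0 < d / 3 by rewrite divr_gt0.
  have := finitely_colored_preim f (IH (r + d / 3) _ d3).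
  have fle x : x \in lspan (e :: s) -> p x <= r -> p (f x) <= r + d / 3.
    move=> xs xr; have [_ fx] := fP _ xs.
    rewrite -(subrK x (f x)); apply: le_trans (pD _ _) _.
    by rewrite (seminorm_distC sp) addrC lerD.
  apply: finitely_coloredW => x y xy xs ys xr yr.
  have [fxs fx] := fP _ xs; have [fys fy] := fP _ ys.
  have {}xy := xy fxs fys (fle _ xs xr) (fle _ ys yr).
  apply: le_trans (seminorm_distD sp (f x) _ _) _.
  have := seminorm_distD sp (f y) (f x) y.
  by rewrite (seminorm_distC sp (f y) y); lra.
Qed.

End Span.

Lemma lspan_map (R : realType) (V W : lmodType R) (f : {linear V -> W}) s x :
  x \in lspan s -> f x \in lspan (map f s).
Proof.
elim: s x => [x /lspan_nilP ->|e s IH x /lspan_consP[c /IH xs]].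
  by rewrite linear0 rpred0.
by apply/lspan_consP; exists c; rewrite -linearZ_LR -linearB.
Qed.

(** * Embeddings of multi-seminormed spaces *)

HB.instance Definition _ (R : realType) (X Y : multiseminormed R) :=
  gen_eqMixin (emb X Y).
HB.instance Definition _ (R : realType) (X Y : multiseminormed R) :=
  gen_choiceMixin (emb X Y).

Section Embeddings.
Context {R : realType}.
Implicit Types X Y Z E : multiseminormed R.

Lemma emb_ext X Y (f g : emb X Y) : f =1 g -> f = g.
Proof.
case: f g => [f fl fi fn] [g gl gi gn] /= fg.
have {}fg : f = g.
  case: f g fg {fl fi fn gl gi gn} => [f cf] [g cg] /= /funext fg.
  rewrite fg in cf cg *; congr GRing.Linear.Pack.
  case: cf cg => [[fD] [fZ]] [[gD] [gZ]].
  by rewrite (Prop_irrelevance fD gD) (Prop_irrelevance fZ gZ).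
rewrite fg in fl fi fn gl gi gn *.
by congr Emb; exact: Prop_irrelevance.
Qed.

Lemma len_lt_le m (l l' : mslength) : len_lt m l -> len_le l l' -> len_lt m l'.
Proof. by case: l l' => [k|] [k'|] //=; exact: leq_trans. Qed.

Lemma len_le_trans (l2 l1 l3 : mslength) :
  len_le l1 l2 -> len_le l2 l3 -> len_le l1 l3.
Proof. by case: l1 l2 l3 => [?|] [?|] [?|] //=; exact: leq_trans. Qed.

Section Composition.
Variables (X Y Z : multiseminormed R) (g : emb Y Z) (f : emb X Y).

Lemma emb_comp_norm m : len_lt m (mslen X) ->
  forall x, msnorm Z m ((g \o f) x) = msnorm X m x.
Proof.
by move=> mX x /=; rewrite !emb_norm//; exact: len_lt_le mX (emb_len f).
Qed.

Definition emb_comp : emb X Z :=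
  Emb (emb_lin := g \o f) (len_le_trans (emb_len f) (emb_len g))
    (inj_comp (@emb_inj _ _ _ g) (@emb_inj _ _ _ f)) emb_comp_norm.

End Composition.

Section Restriction.
Variables (E : multiseminormed R) (S : submodClosed E) (n : nat).
Variables (n_gt0 : (0 < n)%N) (n_le : len_le (Some n) (mslen E)).

Definition emb_incl : emb (restr S n_gt0 n_le) E :=
  @Emb _ (restr S n_gt0 n_le) E (\val : {linear subspace_type S -> E})
    n_le val_inj (fun _ _ _ => erefl).

Section Corestriction.
Variables (X : multiseminormed R) (f : emb X E).
Hypotheses (lenX : len_le (mslen X) (Some n)) (fS : forall x, f x \in S).

Definition corestr_fun (x : X) : subspace_type S := exist _ (f x) (fS x).

Lemma corestr_linear : linear corestr_fun.
Proof. by move=> a x y; apply: val_inj; rewrite /= linearP. Qed.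

HB.instance Definition _ :=
  GRing.isLinear.Build R X (subspace_type S) *:%R corestr_fun corestr_linear.

Lemma corestr_inj : injective corestr_fun.
Proof. by move=> x y /(congr1 val)/(@emb_inj _ _ _ f). Qed.

Definition corestr : emb X (restr S n_gt0 n_le) :=
  @Emb _ X (restr S n_gt0 n_le) corestr_fun lenX corestr_inj
    (fun m mX x => emb_norm f mX x).

Lemma corestrK : emb_comp emb_incl corestr = f.
Proof. by apply: emb_ext => x. Qed.

End Corestriction.
End Restriction.

(** The condition that the norm of f - g is at most d for every seminorm of X,
written so that suprema do not occur; see [opcloseP]. *)
Definition opclose X Y (d : R) (f g : X -> Y) : Prop :=
  forall m, len_lt m (mslen X) ->
  forall x, msnorm Y m (f x - g x) <= d * msnorm X m x.

Section OpClose.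
Variables X Y : multiseminormed R.
Implicit Types f g h : emb X Y.

Lemma emb_seminorm m :
  emb X Y -> len_lt m (mslen X) -> seminorm (@msnorm _ Y m).
Proof. by move=> f mX; exact: msnormP (len_lt_le mX (emb_len f)). Qed.

Lemma sub_embZ f g (a : R) x : f (a *: x) - g (a *: x) = a *: (f x - g x).
Proof. by rewrite scalerBr !linearZ_LR. Qed.

Lemma opclose_ball (d : R) f g :
  (forall m, len_lt m (mslen X) ->
   forall x, msnorm X m x <= 1 -> msnorm Y m (f x - g x) <= d) ->
  opclose d f g.
Proof.
move=> fg m mX; apply: (seminorm_le_ball (msnormP mX) (emb_seminorm f mX)).
  exact: sub_embZ.
exact: fg.
Qed.

Lemma opcloseP (d : R) f g : 0 <= d ->
  (forall m, len_lt m (mslen X) -> (opnorm m (fun x => f x - g x)%R <= d%:E)%E)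
  <-> opclose d f g.
Proof.
move=> d0; split=> fg.
  apply: opclose_ball => m mX x x1; rewrite -lee_fin.
  exact: le_trans (le_opnorm (fun x => f x - g x) x1) (fg m mX).
move=> m mX; apply: opnorm_le => x x1; apply: le_trans (fg m mX x) _.
by rewrite ler_piMr.
Qed.

Lemma opclose_refl f : opclose 0 f f.
Proof.
by move=> m mX x; rewrite subrr (seminorm0 (emb_seminorm f mX)) mul0r.
Qed.

Lemma opcloseC (d : R) f g : opclose d f g -> opclose d g f.
Proof.
by move=> fg m mX x; rewrite (seminorm_distC (emb_seminorm f mX)) fg.
Qed.

Lemma opclose_trans (d e : R) g f h :
  opclose d f g -> opclose e g h -> opclose (d + e) f h.
Proof.
move=> fg gh m mX x; rewrite mulrDl.
apply: le_trans (seminorm_distD (emb_seminorm f mX) (g x) _ _) _.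
by rewrite lerD ?fg ?gh.
Qed.

Lemma opcloseW (d e : R) f g : d <= e -> opclose d f g -> opclose e f g.
Proof.
move=> de fg m mX x; apply: le_trans (fg m mX x) _.
by rewrite ler_wpM2r//; have [p0 _ _] := msnormP mX.
Qed.

End OpClose.

Lemma opclose_compl X Y Z (d : R) (h : emb Y Z) (f g : emb X Y) :
  opclose d f g -> opclose d (emb_comp h f) (emb_comp h g).
Proof.
move=> fg m mX x /=; rewrite -linearB emb_norm ?fg//.
exact: len_lt_le mX (emb_len f).
Qed.

Lemma opclose_compr X Y Z (d : R) (f g : emb Y Z) (h : emb X Y) :
  opclose d f g -> opclose d (emb_comp f h) (emb_comp g h).
Proof.
move=> fg m mX x /=; rewrite -(emb_norm h mX).
by apply: fg; exact: len_lt_le mX (emb_len h).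
Qed.

(** An isometric embedding is determined, up to a small error on the whole unit
ball, by the approximate position of the images of a finite net of that ball;
these images lie in the unit ball of Y, which has a finite coloring.  The error
d splits into d/4 for the net in X, once for each of f and g, and d/4 for the
coloring of Y. *)
Lemma emb_finitely_colored X Y n (d : R) :
  mslen X = Some n -> finite_dimensional X -> finite_dimensional Y -> 0 < d ->
  finitely_colored (fun f g : emb X Y => opclose d f g).
Proof.
move=> lenX /finite_dimensional_lspan[s sX] /finite_dimensional_lspan[t tY] d0.
have [[f0]|NX] := pselect (inhabited (emb X Y)); last first.
  by exists unit, (fun=> tt) => f; case: NX; exists.
have d4 : 0 < d / 4 by rewrite divr_gt0.
suff : finitely_colored (fun f g : emb X Y => forall m, m \in iota 0 n ->
    forall x, msnorm X m x <= 1 -> msnorm Y m (f x - g x) <= d).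
  apply: finitely_coloredW => f g fg; apply: opclose_ball => m.
  by rewrite lenX => mn; apply: fg; rewrite mem_iota.
apply: finitely_colored_seq => m; rewrite mem_iota add0n => /= mn.
have mX : len_lt m (mslen X) by rewrite lenX.
have sp := msnormP mX; have sq := emb_seminorm f0 mX.
have [A [A1 AX]] := finitely_colored_net (fun x => msnorm X m x <= 1)
  (lspan_ball_finitely_colored s 1 sp d4).
have : finitely_colored (fun f g : emb X Y => forall a, a \in A ->
    msnorm Y m (f a) <= 1 -> msnorm Y m (g a) <= 1 ->
    msnorm Y m (f a - g a) <= d / 4).
  apply: finitely_colored_seq => a _.
  have := finitely_colored_preim (fun f : emb X Y => f a)
    (lspan_ball_finitely_colored t 1 sq d4).
  by apply: finitely_coloredW => f g; exact.
apply: finitely_coloredW => f g fg x x1.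
have [a aA ax] := AX x x1.
have {}ax := ax (sX a) (sX x) (A1 a aA) x1.
have {}fg : msnorm Y m (f a - g a) <= d / 4.
  by apply: fg; rewrite ?emb_norm// A1.
have fax (h : emb X Y) : msnorm Y m (h a - h x) <= d / 4.
  by rewrite -linearB emb_norm.
have := seminorm_distD sq (f a) (f x) (g x).
have := seminorm_distD sq (g a) (f a) (g x).
have := fax f; have := fax g.
rewrite (seminorm_distC sq (f x) (f a)); lra.
Qed.

Lemma emb_net X Y n (d : R) :
  mslen X = Some n -> finite_dimensional X -> finite_dimensional Y -> 0 < d ->
  exists s : seq (emb X Y),
    forall f : emb X Y, exists2 g, g \in s & opclose d g f.
Proof.
move=> lenX fX fY d0.
have [s [_ sP]] := finitely_colored_net (fun=> True)
  (emb_finitely_colored lenX fX fY d0).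
by exists s => f; have [g gs gf] := sP f I; exists g.
Qed.

Lemma ultrahomogeneous_opclose E X :
  approximately_ultrahomogeneous E -> Age E X ->
  forall (d : R) (f h : emb X E), 0 < d ->
  exists g : iso E, opclose d (emb_comp g f) h.
Proof.
move=> uE AX d f h d0; have [g gP] := uE d X d0 AX f h.
by exists g; apply/(opcloseP (emb_comp g f) h (ltW d0)).
Qed.

Lemma Age_restr_lspan E n (n_gt0 : (0 < n)%N) (n_le : len_le (Some n) (mslen E))
    (s : seq E) :
  Age_len E n (restr (lspan s) n_gt0 n_le).
Proof.
exists (lspan s), n_gt0, n_le; split => //; exact: lspan_finite_dimensional.
Qed.

End Embeddings.

Arguments opclose {R X Y} d f g.

(** * The topology of pointwise convergence *)

Section Seqs.
Variable T : eqType.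

(** The filter of the finite lists that contain any prescribed finite list; on
vectors, through [lspan], it expresses convergence along the directed family of
finitely generated subspaces. *)
Definition eventually_seq : set_system (seq T) :=
  filter_from [set: seq T] (fun s => [set t : seq T | {subset s <= t}]).

Global Instance eventually_seq_filter : ProperFilter eventually_seq.
Proof.
apply: filter_from_proper; last by move=> s _; exists s.
apply: filter_from_filter; first by exists [::].
move=> s t _ _; exists (s ++ t) => // u stu.
by split=> x xs; apply: stu; rewrite mem_cat xs ?orbT.
Qed.

End Seqs.

Section IsoNbhs.
Context {R : realType} (E : multiseminormed R).

(** Finitely many of the generating open sets around 1 are controlled by a single
finitely generated subspace and a single number of seminorms: concatenate the
generators, and take the largest number of seminorms and the smallest d. *)
Lemma iso1_nbhs (N : set (iso E)) : nbhs (1%g : iso E) N ->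
  exists (n : nat) (s : seq E) (d : R),
    [/\ (0 < n)%N, len_le (Some n) (mslen E), 0 < d &
      forall u : iso E, (forall m, (m < n)%N -> forall y, y \in lspan s ->
        msnorm E m (u y - y) <= d * msnorm E m y) -> N u].
Proof.
pose base (N : set (iso E)) := exists (n : nat) (s : seq E) (d : R),
    [/\ (0 < n)%N, len_le (Some n) (mslen E), 0 < d &
      forall u : iso E, (forall m, (m < n)%N -> forall y, y \in lspan s ->
        msnorm E m (u y - y) <= d * msnorm E m y) -> N u].
have baseF : Filter base.
  split.
  - by exists 1%N, [::], 1; split => //; exact: mslen_ge1.
  - move=> P Q [n [s [d [n0 nE d0 sP]]]] [k [t [e [k0 kE e0 tQ]]]].
    exists (maxn n k), (s ++ t), (Num.min d e); split.
    + by rewrite leq_max n0.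
    + by case: (mslen E) nE kE => //= l; rewrite geq_max => -> ->.
    + by rewrite lt_min d0.
    move=> u uP; split.
      apply: sP => m mn y ys; apply: le_trans (uP m _ y _) _.
      * by rewrite leq_max mn.
      * by apply: lspan_mono ys => x xs; rewrite mem_cat xs.
      rewrite ler_wpM2r ?ge_min ?lexx//.
      by have [] := msnormP (iso_len_lt nE mn).
    apply: tQ => m mn y ys; apply: le_trans (uP m _ y _) _.
    * by rewrite leq_max mn orbT.
    * by apply: lspan_mono ys => x xs; rewrite mem_cat xs orbT.
    rewrite ler_wpM2r ?ge_min ?lexx ?orbT//.
    by have [] := msnormP (iso_len_lt kE mn).
  - move=> P Q PQ [n [s [d [n0 nE d0 sP]]]]; exists n, s, d; split => // u uP.
    exact/PQ/sP.
suff : @nbhs _ (iso E) 1%g `<=` base by exact.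
apply: iso_cvg => _ [f [Y [eps [n [n0 [nE [[k [e eP]] e0 ->]]]]]]].
move=> /lt_unif[c ceps cP].
(* The open set is centred at some f; as it contains 1 and is defined by strict
   inequalities, c < eps leaves room for moving away from 1. *)
exists n, [seq \val (e i) | i : 'I_k], ((eps - c) / 2); split => //.
  by rewrite divr_gt0// subr_gt0.
move=> u uP m mn; have sE := msnormP (iso_len_lt nE mn).
apply: (@le_lt_trans _ _ (c + (eps - c) / 2)%:E); last by rewrite lte_fin; lra.
apply: opnorm_le => y y1.
apply: le_trans (seminorm_distD sE (\val y) _ _) _; apply: lerD.
  by rewrite -lee_fin; apply: le_trans (cP m mn); exact: le_opnorm y1.
rewrite (seminorm_distC sE); apply: le_trans (uP m mn _ _) _.
  have [a ->] := eP y; rewrite linear_sum rpred_sum// => i _.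
  rewrite linearZ rpredZ//.
  by apply: mem_lspan; apply/mapP; exists i; rewrite ?mem_enum.
by rewrite ler_piMr// ?divr_ge0// subr_ge0 ltW.
Qed.

(** Composing with an embedding of a finite-dimensional space is continuous for
the norm on embeddings. *)
Lemma nbhs_iso_opclose X (f : emb X E) (g : iso E) n (d : R) :
  mslen X = Some n -> finite_dimensional X -> 0 < d ->
  nbhs g [set h : iso E | opclose d (emb_comp h f) (emb_comp g f)].
Proof.
move=> lenX /finite_dimensional_lspan[s sX] d0.
have n0 : (0 < n)%N by have := mslen_ge1 X; rewrite lenX.
have nE : len_le (Some n) (mslen E) by rewrite -lenX; exact: emb_len f.
have := @nbhs_iso_near _ E g (lspan (map f s)) d n n0 nE
  (lspan_finite_dimensional _) d0.
apply: filterS => h gh; apply: opcloseC; apply: opclose_ball => m mX x x1.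
apply: gh; [by move: mX; rewrite lenX| |by rewrite emb_norm].
exact: lspan_map.
Qed.

End IsoNbhs.

(** * The Ramsey property gives fixed points *)

Lemma filter_seq (T : Type) (I : eqType) (F : set_system T) (s : seq I)
    (M : I -> set T) : Filter F ->
  (forall i, i \in s -> F (M i)) -> F [set u | forall i, i \in s -> M i u].
Proof.
move=> FF; elim: s => [_|i s IH FM]; first exact: filterE.
have FMs : F [set u | forall j, j \in s -> M j u].
  by apply: IH => j js; apply: FM; rewrite in_cons js orbT.
apply: filterS (filterI (FM i (mem_head _ _)) FMs) => u [Mi Ms] j.
by rewrite in_cons => /predU1P[->//|/Ms].
Qed.

(** V_x is a neighbourhood of x that is disjoint from its translate by an element
h_x that moves x; continuity of the action at (1, x) gives W_x and a
neighbourhood of 1 that maps it into V_x.  Compactness keeps finitely many of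
the W_x. *)
Lemma fixed_point_free_cover (G : topologicalGroupType) (K : topologicalType)
    (a : G -> K -> K) :
  compact [set: K] -> hausdorff_space K -> continuous_action a ->
  (forall x, exists g, a g x <> x) ->
  exists (N : set G) (s : seq K) (V W : K -> set K) (h : K -> G),
  [/\ nbhs 1%g N,
      forall x, exists2 y, y \in s & W y x,
      forall y u x, y \in s -> N u -> W y x -> V y (a u x) &
      forall y x, V y x -> ~ V y (a (h y) x)].
Proof.
move=> cK hK [a1 aM ac] moved.
have local (x : K) : exists (g : G) (V W : set K) (M : set G),
    [/\ nbhs x W, nbhs 1%g M, forall u z, M u -> W z -> V (a u z) &
      forall z, V z -> ~ V (a g z)].
  have [g /eqP gx] := moved x.
  have := hK; rewrite open_hausdorff => /(_ _ _ gx).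
  move=> [[B A] /= [gxB xA] [oB oA BA0]].
  move: gxB xA; rewrite !inE => gxB xA.
  have [[P Q] /= [Pg Qx] PQB] := ac (g, x) B (open_nbhs_nbhs (conj oB gxB)).
  have : nbhs x (A `&` Q) by apply: filterI => //; exact: open_nbhs_nbhs.
  rewrite -{1}(a1 x) => /(ac (1%g, x)) [[M W] /= [M1 Wx] MWV].
  exists g, (A `&` Q), W, M; split => //.
    by move=> u z Mu Wz; exact: (MWV (u, z)).
  move=> z [_ Qz] [Agz _].
  have : (B `&` A) (a g z).
    split=> //; apply: (PQB (g, z)); split=> //; exact: nbhs_singleton Pg.
  by move/eqP: BA0 => ->.
have /choice[h /choice[V /choice[W /choice[M hP]]]] := local.
have /compact_near_coveringP/(_ _ (eventually_seq (T:=K))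
  (fun s x => exists2 y, y \in s & W y x) _) cov := cK.
have [x _|t _ st] := cov.
  exists (W x, [set t | x \in t]) => /=.
    split; first by have [] := hP x.
    by exists [:: x] => // t; apply; rewrite mem_head.
  by move=> [z t] /= [Wz xt]; exists x.
exists [set u | forall y, y \in t -> M y u], t, V, W, h; split.
- by apply: filter_seq => y _; have [] := hP y.
- by move=> x; apply: (st t).
- by move=> y u x yt Mu; have [_ _ + _] := hP y; apply; exact: Mu.
- by move=> y; have [] := hP y.
Qed.

Section RamseyToFixedPoint.
Context {R : realType} (E : multiseminormed R).
Hypothesis uE : approximately_ultrahomogeneous E.

(** An embedding is colored by where the inverse of an isometry that approximates
it sends x0; taking inverses turns closeness on X into closeness in K. *)
Lemma ramsey_extremely_amenable :
  (forall n : nat, (1 <= n)%N -> len_le (Some n) (mslen E) ->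
     approximate_ramsey (Age_len E n)) ->
  extremely_amenable (iso E).
Proof.
move=> ramsey K a [x0 _] cK hK ca; apply: contrapT => Nfix.
have [x|N [s [V [W [h [N1 covW VN Vh]]]]]] := fixed_point_free_cover cK hK ca.
  apply: contrapT => Nx; apply: Nfix; exists x => g.
  by apply: contrapT => gx; apply: Nx; exists g.
have [a1 aM _] := ca.
have [n [t [d [n0 nE d0 NP]]]] := iso1_nbhs N1.
pose X := restr (lspan t) n0 nE.
(* Y has to contain the copies of X under g^-1 for g = 1 and g = h_y. *)
pose t' := flatten [seq map (iso_inv g) t | g <- 1%g :: map h s].
pose Y := restr (lspan t') n0 nE.
pose iX : emb X E := emb_incl _ n0 nE.
pose iY : emb Y E := emb_incl _ n0 nE.
have XY (g : iso E) : g \in (1%g :: map h s) ->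
    exists xi : emb X Y, emb_comp iY xi = emb_comp (iso_inv g) iX.
  move=> gs.
  have gX x : emb_comp (iso_inv g) iX x \in lspan t'.
    have : iX x \in lspan t by exact: valP x.
    move/(lspan_map (iso_inv g)) => /=; apply: lspan_mono => y yt.
    by apply/flatten_mapP; exists g.
  by exists (@corestr _ E _ n n0 nE X _ (leqnn n) gX); rewrite corestrK.
have d3 : 0 < d / 3 by rewrite divr_gt0.
have AX : Age E X by exists n; exact: Age_restr_lspan.
have AY : Age E Y by exists n; exact: Age_restr_lspan.
have s0 : (0 < size s)%N by have [y ys _] := covW x0; case: (s) ys.
have [_ [S [k0 [kE [fS ->]]]] ramZ] := ramsey n n0 nE X Y
  (Age_restr_lspan _ _ _) (Age_restr_lspan _ _ _) (size s) (d / 3) s0 d3.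
set Z := restr S k0 kE in ramZ.
pose iZ : emb Z E := emb_incl S k0 kE.
have /choice[c cP] : forall eta : emb X Z, exists i : 'I_(size s),
    exists2 k : iso E, opclose (d / 3) (emb_comp k iX) (emb_comp iZ eta) &
      W (nth x0 s i) (a k^-1%g x0).
  move=> eta; have [k kP] :=
    ultrahomogeneous_opclose uE AX iX (emb_comp iZ eta) d3.
  have [y ys Wy] := covW (a k^-1%g x0).
  have ysi : (index y s < size s)%N by rewrite index_mem.
  by exists (Ordinal ysi), k => //=; rewrite nth_index.
have [gamma [i gammaP]] := ramZ c.
have [l lP] := ultrahomogeneous_opclose uE AY iY (emb_comp iZ gamma) d3.
(* Both l g^-1 and the isometry k attached to the color i approximate the same
   copy of X, each up to d / 3, and a further d / 3 comes from the coloring.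
   Hence g l^-1 k lies in N and maps the point k^-1 x0 of W_i into V_i. *)
have inV (g : iso E) : g \in (1%g :: map h s) ->
    V (nth x0 s i) (a g (a l^-1%g x0)).
  move=> gs; have [xi xiP] := XY g gs.
  have [eta ci /(opcloseP (emb_comp gamma xi) eta (ltW d3)) etaP] := gammaP xi.
  have [k kX Wk] := cP eta; rewrite ci in Wk.
  have -> : a g (a l^-1%g x0) = a (g * l^-1 * k)%g (a k^-1%g x0).
    by rewrite -!aM -!mulgA mulgV mulg1.
  apply: VN Wk; first by rewrite mem_nth.
  apply: NP => m mn y yt.
  have := opclose_trans kX (opclose_trans (opcloseC (opclose_compl iZ etaP))
    (opcloseC (opclose_compr xi lP))).
  move=> /(_ m mn (exist _ y yt)).
  have -> : d / 3 + (d / 3 + d / 3) = d by lra.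
  apply: le_trans; have xiy := congr1 (fun f : emb X E => f (exist _ y yt)) xiP.
  rewrite /= in xiy; rewrite /= xiy.
  have -> : (g * l^-1 * k)%g y - y = (g * l^-1)%g (k y - l (iso_inv g y)).
    rewrite linearB; congr (_ - _).
    by rewrite /= iso_funK iso_inv_funK.
  by rewrite iso_norm//; exact: iso_len_lt nE mn.
apply: (Vh (nth x0 s i) (a l^-1%g x0)).
  by rewrite -[X in V _ X]a1; apply: inV; rewrite mem_head.
by apply: inV; rewrite in_cons map_f ?orbT// mem_nth.
Qed.

End RamseyToFixedPoint.

(** * Closed subspaces of products *)

Lemma cvg_prod_topology (I : eqType) (T : I -> topologicalType)
    (F : set_system (prod_topology T)) (f : prod_topology T) : Filter F ->
  (forall i, (fun g : prod_topology T => g i) @ F --> f i) -> F --> f.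
Proof.
move=> FF Ff; apply/cvg_sup => i A [_ [[B oB <-] Bf] BA].
rewrite nbhs_filterE; apply: filterS BA _.
by apply: (Ff i B); exact: open_nbhs_nbhs.
Qed.

Section SetType.
Context {X : topologicalType} (A : set X).

Lemma compact_set_type : compact A -> compact [set: set_type A].
Proof.
move=> cA F FF FT.
have [|p [Ap Fp]] := cA (set_val @ F) _.
  by apply: (@filterS _ F _ setT) => // x _ /=; exact: set_valP.
exists (exist _ p (mem_set Ap)); split=> // B C FB [_ [[D oD <-] /= Dp] DC].
have [|x [[y By <-] Dx]] := Fp (set_val @` B) D _ (open_nbhs_nbhs (conj oD Dp)).
  by apply: (@filterS _ F _ B) => // y By; exists y.
by exists y; split=> //; exact: DC.
Qed.

Lemma cvg_set_type (F : set_system (set_type A)) (x : set_type A) : Filter F ->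
  set_val @ F --> set_val x -> F --> x.
Proof.
move=> FF Fx B [_ [[D oD <-] /= Dx] DB]; rewrite nbhs_filterE.
by apply: filterS DB _; apply: (Fx D); exact: open_nbhs_nbhs.
Qed.

Lemma hausdorff_set_type : hausdorff_space X -> hausdorff_space (set_type A).
Proof.
move=> hX x y xy; apply: val_inj; apply: hX => B C Bx Cy.
have [z [Bz Cz]] := xy (set_val @^-1` B) (set_val @^-1` C)
  (initial_continuous Bx) (initial_continuous Cy).
by exists (set_val z).
Qed.

End SetType.

Lemma closed_cluster (T : topologicalType) (F : set_system T) (A : set T) p :
  closed A -> F A -> cluster F p -> A p.
Proof. by move=> cA FA Fp; apply: cA => B; exact: Fp. Qed.

Lemma closed_exists (T : topologicalType) (I : choiceType) (s : seq I)
    (F : I -> set T) :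
  (forall i, closed (F i)) -> closed [set x | exists2 i, i \in s & F i x].
Proof.
by move=> cF; apply: (closed_bigcup (finite_seq s)) => i _; exact: cF.
Qed.

Section Evaluations.
Context {R : realType} (I : eqType).
Implicit Types (i j : I) (c : R).
Local Notation P := {ptws I -> R}.

Lemma eval_continuous i : continuous (fun f : P => f i).
Proof. exact: (@proj_continuous I (fun=> R) i). Qed.

Lemma closed_eval_le i c : closed [set f : P | f i <= c].
Proof.
apply: (@preimage_closed _ _ _ [set x | x <= c]); last exact: closed_le.
by move=> f _; exact: eval_continuous.
Qed.

Lemma closed_eval_ge i c : closed [set f : P | c <= f i].
Proof.
apply: (@preimage_closed _ _ _ [set x | c <= x]); last exact: closed_ge.
by move=> f _; exact: eval_continuous.
Qed.

Lemma closed_eval_dist i j c : closed [set f : P | `|f i - f j| <= c].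
Proof.
apply: (@preimage_closed _ _ (fun f : P => `|f i - f j|) [set x | x <= c]);
  last exact: closed_le.
move=> f _.
have fi : (fun g : P => g i) @ nbhs f --> f i := @eval_continuous i f.
have fj : (fun g : P => g j) @ nbhs f --> f j := @eval_continuous j f.
exact: (cvg_norm (cvgB fi fj)).
Qed.

End Evaluations.

(** * Lipschitz functions on embeddings *)

Section TruncatedDistance.
Context {R : realType} (X E : multiseminormed R).
Implicit Types (C : set (emb X E)) (f g h : emb X E).

Definition op_lipschitz (phi : emb X E -> R) : Prop :=
  forall d f g, 0 <= d -> opclose d f g -> `|phi f - phi g| <= d.

(** The value 1 truncates the distance to the set C, and gives the distance to an
empty color class. *)
Definition tdist_set C f : set R :=
  [set d | 0 <= d /\ (d = 1 \/ exists2 g, C g & opclose d f g)].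

Definition tdist C f : R := inf (tdist_set C f).

Lemma tdist_set_lbound C f : has_lbound (tdist_set C f).
Proof. by exists 0 => d []. Qed.

Lemma tdist_set1 C f : tdist_set C f 1.
Proof. by split=> //; left. Qed.

Lemma tdist_ge C f (c : R) : lbound (tdist_set C f) c -> c <= tdist C f.
Proof. by apply: lb_le_inf; exists 1; exact: tdist_set1. Qed.

Lemma tdist_ge0 C f : 0 <= tdist C f.
Proof. by apply: tdist_ge => d []. Qed.

Lemma tdist_le1 C f : tdist C f <= 1.
Proof. by apply: ge_inf; [exact: tdist_set_lbound|exact: tdist_set1]. Qed.

Lemma tdist_le0 C f : C f -> tdist C f <= 0.
Proof.
move=> Cf; apply: ge_inf; first exact: tdist_set_lbound.
by split=> //; right; exists f => //; exact: opclose_refl.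
Qed.

(** The minimum with 1 accounts for the truncation. *)
Lemma tdist_far C f (e : R) : (forall g, C g -> ~ opclose e f g) ->
  Num.min e 1 <= tdist C f.
Proof.
move=> far; apply: tdist_ge => d [d0 [->|[g Cg fg]]].
  by rewrite ge_min lexx orbT.
rewrite ge_min; have [//|de] := leP e d.
by case: (far g Cg); exact: opcloseW (ltW de) fg.
Qed.

Lemma tdist_lipschitz C : op_lipschitz (tdist C).
Proof.
have le_tdist (d : R) f g :
    0 <= d -> opclose d f g -> tdist C f <= d + tdist C g.
  move=> d0 fg; rewrite -lerBlDl; apply: tdist_ge => e [e0 eP].
  rewrite lerBlDl; case: eP => [->|[h Ch gh]].
    by apply: le_trans (tdist_le1 C f) _; rewrite lerDr.
  apply: ge_inf; first exact: tdist_set_lbound.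
  split; first exact: addr_ge0.
  by right; exists h => //; exact: opclose_trans fg gh.
move=> d f g d0 fg; have := le_tdist d f g d0 fg.
have := le_tdist d g f d0 (opcloseC fg).
by rewrite ler_norml => ? ?; apply/andP; split; lra.
Qed.

End TruncatedDistance.

Lemma iso_inv_funM (R : realType) (E : multiseminormed R) (g h : iso E) x :
  iso_inv_fun (iso_comp g h) x = iso_inv_fun h (iso_inv_fun g x).
Proof.
apply: (@emb_inj _ _ _ (iso_comp g h)).
by rewrite iso_inv_funK /= !iso_inv_funK.
Qed.

Section BadColorings.
Context {R : realType} (X Y E : multiseminormed R) (r : nat).
Variables (L : seq (emb X Y)) (b : R).
Local Notation P := {ptws (emb X E * 'I_r)%type -> R}.

(** The i-th function f (_, i) plays the role of the distance to the i-th color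
class: some color is at distance 0 from each embedding, yet each copy gamma of Y
contains, for each color, a copy of X at distance at least b from that color.
All existential quantifiers range over finite lists, so that the set is closed
for pointwise convergence. *)
Definition bad_colorings : set P := [set f |
  [/\ forall k, 0 <= f k <= 1,
      forall i, op_lipschitz (fun eta => f (eta, i)),
      forall eta, exists2 i, i \in enum 'I_r & f (eta, i) <= 0 &
      forall (gamma : emb Y E) i,
        exists2 xi, xi \in L & b <= f (emb_comp gamma xi, i)]].

(** Each condition is closed and involves finitely many coordinates, so it passes
to cluster points as soon as it holds eventually, with no uniformity between
the conditions. *)
Lemma cluster_bad_colorings (F : set_system P) :
  (forall k, F [set f | 0 <= f k]) -> (forall k, F [set f | f k <= 1]) ->
  (forall (i : 'I_r) (d : R) (eta zeta : emb X E),
     0 <= d -> opclose d eta zeta ->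
     F [set f | `|f (eta, i) - f (zeta, i)| <= d]) ->
  (forall eta : emb X E,
     F [set f | exists2 i, i \in enum 'I_r & f (eta, i) <= 0]) ->
  (forall (gamma : emb Y E) (i : 'I_r),
     F [set f | exists2 xi, xi \in L & b <= f (emb_comp gamma xi, i)]) ->
  cluster F `<=` bad_colorings.
Proof.
move=> F0 F1 Flip Fcol Fbad f Ff; split.
- move=> k; apply/andP; split.
    exact: (closed_cluster (@closed_eval_ge _ _ k 0) (F0 k) Ff).
  exact: (closed_cluster (@closed_eval_le _ _ k 1) (F1 k) Ff).
- move=> i d eta zeta d0 ez.
  exact: (closed_cluster (@closed_eval_dist _ _ (eta, i) (zeta, i) d)
    (Flip i d eta zeta d0 ez) Ff).
- move=> eta; apply: (closed_cluster _ (Fcol eta) Ff).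
  by apply: closed_exists => i; exact: closed_eval_le.
- move=> gamma i; apply: (closed_cluster _ (Fbad gamma i) Ff).
  by apply: closed_exists => xi; exact: closed_eval_ge.
Qed.

Lemma closed_bad_colorings : closed bad_colorings.
Proof.
rewrite /closed closureEcluster.
apply: cluster_bad_colorings => [k|k|i d eta zeta d0 ez|eta|gamma i] f
  [f01 flip fcol fbad].
- by have /andP[] := f01 k.
- by have /andP[] := f01 k.
- exact: flip.
- exact: fcol.
- exact: fbad.
Qed.

Lemma compact_unit_box : compact [set f : P | forall k, `[0, 1]%classic (f k)].
Proof.
apply: (@tychonoff _ (fun _ : emb X E * 'I_r => R)
  (fun=> `[0, 1]%classic)) => k.
exact: segment_compact.
Qed.

Lemma compact_bad_colorings : compact bad_colorings.
Proof.
apply: (subclosed_compact closed_bad_colorings compact_unit_box).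
by move=> f [f01 _ _ _] k /=; rewrite in_itv /= f01.
Qed.

Definition translate (g : iso E) (f : P) : P :=
  fun k => f (emb_comp (iso_inv g) k.1, k.2).

Lemma translate_bad g f : bad_colorings f -> bad_colorings (translate g f).
Proof.
move=> [f01 flip fcol fbad]; split.
- by move=> k; exact: (f01 (emb_comp (iso_inv g) k.1, k.2)).
- by move=> i d eta zeta d0 ez; apply: flip => //; exact: opclose_compl.
- by move=> eta; exact: (fcol (emb_comp (iso_inv g) eta)).
move=> gamma i; have [xi xiL bf] := fbad (emb_comp (iso_inv g) gamma) i.
exists xi => //; rewrite /translate/= (_ : emb_comp _ (emb_comp gamma xi) =
  emb_comp (emb_comp (iso_inv g) gamma) xi)//.
exact: emb_ext.
Qed.

Definition translate_act (g : iso E) (f : set_type bad_colorings) :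
    set_type bad_colorings :=
  exist _ (translate g (set_val f)) (mem_set (translate_bad g (set_valP f))).

(** Joint continuity at (g, f): moving g changes the embedding at which the
functions are evaluated, which matters little as all the functions are
1-Lipschitz, and moving f is pointwise convergence at a fixed embedding. *)
Lemma translate_continuous_action n :
  mslen X = Some n -> finite_dimensional X -> continuous_action translate_act.
Proof.
move=> lenX fX; split.
- move=> f; apply: val_inj; apply/funext => -[eta i].
  rewrite /= /translate /=; congr (_ (_, _)); apply: emb_ext => x.
  exact: (iso_funK (1%g : iso E)).
- move=> g h f; apply: val_inj; apply/funext => -[eta i].
  rewrite /= /translate /=; congr (_ (_, _)); apply: emb_ext => x /=.
  exact: iso_inv_funM.
- move=> [g f]; apply: cvg_set_type; apply: cvg_prod_topology => -[eta i].
  apply/cvgrPdist_le => e e0 /=; have e2 : 0 < e / 2 by rewrite divr_gt0.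
  pose eta0 := emb_comp (iso_inv g) eta.
  exists ([set h : iso E | opclose (e / 2) (emb_comp (iso_inv h) eta) eta0],
    [set h : set_type bad_colorings |
      `|set_val f (eta0, i) - set_val h (eta0, i)| <= e / 2]).
    split => /=.
      exact: (@iso_invg_continuous _ E g _
        (nbhs_iso_opclose eta (iso_inv g) lenX fX e2)).
    have := @eval_continuous R _ (eta0, i) (set_val f).
    move/cvgrPdist_le => /(_ _ e2).
    exact: initial_continuous.
  move=> [h k] /= [gh fk].
  have [_ klip _ _] := set_valP k.
  have := klip i _ (emb_comp (iso_inv h) eta) eta0 (ltW e2) gh.
  rewrite /translate /= -/eta0 => hk.
  have := ler_distD (set_val k (eta0, i)) (set_val f (eta0, i))
    (set_val k (emb_comp (iso_inv h) eta, i)).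
  rewrite distrC in hk; lra.
Qed.

End BadColorings.

(** * Fixed points give the Ramsey property *)

Section FixedPointToRamsey.
Context {R : realType} (E : multiseminormed R).
Hypothesis uE : approximately_ultrahomogeneous E.

(** Any two embeddings of X are, up to an arbitrarily small error, translates of
each other, and an invariant Lipschitz function does not see the error. *)
Lemma translate_fixed_constant X Y r (L : seq (emb X Y)) (b : R)
    (f : set_type (bad_colorings (E := E) (r := r) L b)) :
  Age E X -> (forall g, translate_act g f = f) ->
  forall (i : 'I_r) (eta zeta : emb X E),
    set_val f (eta, i) = set_val f (zeta, i).
Proof.
move=> AX fixf i eta zeta; apply/eqP; rewrite -subr_eq0 -normr_le0.
apply/ler_addgt0Pl => d d0; rewrite addr0.
have [g gP] := ultrahomogeneous_opclose uE AX eta zeta d0.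
have [_ flip _ _] := set_valP f.
suff -> : set_val f (eta, i) = set_val f (emb_comp g eta, i).
  exact: flip i _ _ _ (ltW d0) gP.
rewrite -[in RHS](fixf g); congr (set_val f (_, _)).
by apply: emb_ext => x /=; rewrite iso_funK.
Qed.

(** The image of eta is spanned by the images of generators of X. *)
Lemma factor_eventually X n (n0 : (0 < n)%N) (nE : len_le (Some n) (mslen E))
    (eta : emb X E) :
  mslen X = Some n -> finite_dimensional X ->
  \forall s \near eventually_seq (T := E),
    exists zeta : emb X (restr (lspan s) n0 nE),
      emb_comp (emb_incl (lspan s) n0 nE) zeta = eta.
Proof.
move=> lenX /finite_dimensional_lspan[t tX]; exists (map eta t) => // s ts.
have etas x : eta x \in lspan s.
  exact: lspan_mono ts _ (lspan_map eta (tX x)).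
have lenXn : len_le (mslen X) (Some n) by rewrite lenX len_leR.
by exists (corestr n0 nE lenXn etas); rewrite corestrK.
Qed.

(** Were there no suitable space, each finitely generated subspace would have a
bad coloring, and a limit of these along [eventually_seq] would make the space
[bad_colorings] nonempty; an invariant element is contradictory. *)
Lemma extremely_amenable_ramsey : extremely_amenable (iso E) ->
  forall n : nat, (1 <= n)%N -> len_le (Some n) (mslen E) ->
    approximate_ramsey (Age_len E n).
Proof.
move=> amenable n n0 nE X Y AX AY r eps r0 eps0; apply: contrapT => NZ.
have [lenX fX] : mslen X = Some n /\ finite_dimensional X.
  by have [S [? [? [? ->]]]] := AX.
have [lenY fY] : mslen Y = Some n /\ finite_dimensional Y.
  by have [S [? [? [? ->]]]] := AY.
pose Z s := restr (lspan s) n0 nE.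
pose iZ s : emb (Z s) E := emb_incl (lspan s) n0 nE.
have bad s : exists c : emb X (Z s) -> 'I_r, forall (gamma : emb Y (Z s)) i,
    exists xi : emb X Y, forall eta, c eta = i ->
      ~ opclose eps (emb_comp gamma xi) eta.
  apply: contrapT => Nc; apply: NZ; exists (Z s); first exact: Age_restr_lspan.
  move=> c; apply: contrapT => Nc'; apply: Nc; exists c => gamma i.
  apply: contrapT => Nxi; apply: Nc'; exists gamma, i => xi.
  apply: contrapT => Neta; apply: Nxi; exists xi => eta ci xe; apply: Neta.
  by exists eta => //; apply/(opcloseP (emb_comp gamma xi) eta (ltW eps0)).
pose c s := projT1 (cid (bad s)).
have cP s : forall (gamma : emb Y (Z s)) i, exists xi : emb X Y,
    forall eta, c s eta = i -> ~ opclose eps (emb_comp gamma xi) eta.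
  exact: projT2 (cid (bad s)).
(* An embedding at distance at least min(eps, 1) = 2 b from a color class is
   within b of a member of the net, which is then at distance at least b. *)
pose b := Num.min eps 1 / 2.
have b0 : 0 < b by rewrite divr_gt0// lt_min eps0 ltr01.
have [L LP] := emb_net lenX fX fY b0.
pose psi s : {ptws (emb X E * 'I_r)%type -> R} :=
  fun k => tdist
    [set emb_comp (iZ s) eta | eta in [set eta | c s eta = k.2]] k.1.
pose F := psi @ eventually_seq (T := E).
have FE (Q : set {ptws (emb X E * 'I_r)%type -> R}) :
    (forall s, Q (psi s)) -> F Q.
  move=> Qpsi; apply: (@filterE _ (eventually_seq (T := E))) => s.
  exact: Qpsi.
have [f [_ Ff]] :
    [set f | forall k, `[0, 1]%classic (f k)] `&` cluster F !=set0.
  apply: compact_unit_box; apply: FE => s k /=.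
  by rewrite in_itv /=; apply/andP; split; [exact: tdist_ge0|exact: tdist_le1].
have {Ff} f_bad : bad_colorings L b f.
  apply: cluster_bad_colorings Ff.
  - by move=> k; apply: FE => s; exact: tdist_ge0.
  - by move=> k; apply: FE => s; exact: tdist_le1.
  - move=> i d eta zeta d0 ez; apply: FE => s.
    exact: tdist_lipschitz d0 ez.
  - move=> eta; apply: filterS (factor_eventually n0 nE eta lenX fX).
    move=> s [zeta <-]; exists (c s zeta); first by rewrite mem_enum.
    by apply: tdist_le0; exists zeta.
  - move=> gamma i; apply: filterS (factor_eventually n0 nE gamma lenY fY).
    move=> s [gamma' <-]; have [xi xiP] := cP s gamma' i.
    have [xi' xiL xix] := LP xi; exists xi' => //.
    have far : Num.min eps 1 <= psi s (emb_comp (emb_comp (iZ s) gamma') xi, i).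
      by apply: tdist_far => _ [eta ci <-] xe; exact: (xiP eta ci xe).
    have := tdist_lipschitz
      [set emb_comp (iZ s) eta | eta in [set eta | c s eta = i]]
      (ltW b0) (opclose_compl (emb_comp (iZ s) gamma') xix).
    have bE : Num.min eps 1 = b + b by rewrite -splitr.
    rewrite bE in far; rewrite ler_norml => /andP[+ _].
    rewrite /psi /= in far *; lra.
have [phi fixphi] : exists phi : set_type (bad_colorings (E := E) (r := r) L b),
    forall g : iso E, translate_act g phi = phi.
  apply: (amenable _ (@translate_act R X Y E r L b)).
  - by exists (exist _ f (mem_set f_bad)).
  - exact/compact_set_type/compact_bad_colorings.
  - apply: hausdorff_set_type.
    by apply: (@hausdorff_product _ (fun=> R)) => k; exact: Rhausdorff.
  - exact: translate_continuous_action lenX fX.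
have AgeX : Age E X by exists n.
have constphi := translate_fixed_constant AgeX fixphi.
have [_ _ pcol pbad] := set_valP phi.
have [SX [x0 [xE [_ XE]]]] := AX; have [SY [y0 [yE [_ YE]]]] := AY.
have [eta] : inhabited (emb X E) by rewrite XE; split; exact: emb_incl.
have [gamma] : inhabited (emb Y E) by rewrite YE; split; exact: emb_incl.
have [i _ phi0] := pcol eta.
have [xi _ phib] := pbad gamma i.
have : b <= set_val phi (eta, i) by rewrite -(constphi i (emb_comp gamma xi)).
by move=> /le_trans/(_ phi0); rewrite leNgt b0.
Qed.

End FixedPointToRamsey.

(** * The equivalence *)

Theorem theorem4p4 (R : realType) (E : multiseminormed R) :
  ~ finite_dimensional E ->
  approximately_ultrahomogeneous E ->
  ((forall n : nat, (1 <= n)%N -> len_le (Some n) (mslen E) ->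
      approximate_ramsey (Age_len E n))
   <-> extremely_amenable (iso E)).
Proof.
move=> _ uE; split; first exact: ramsey_extremely_amenable.
exact: extremely_amenable_ramsey.
Qed.
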